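(* Let $N\ge 3$, and let $f,g,h$ be smooth real-valued functions of $(\bm{\theta}_N,t)$, where $\bm{\theta}_N=(\theta_1,\dots,\theta_N)$, $2\pi$-periodic in each $\theta_j$ (possibly depending on $t$ only). Consider the system $$\frac{d\theta_j}{dt}=f(\bm{\theta}_N,t)+g(\bm{\theta}_N,t)\cos\theta_j+h(\bm{\theta}_N,t)\sin\theta_j,\qquad j=1,\dots,N,$$ with Koopman generator $\mathcal{K}$. Then for any two permutations $\bm{q}_1,\bm{q}_2$ of $\{1,\dots,N\}$, the ratio $$\Psi^N_{\bm{q}_1,\bm{q}_2}(\bm{\theta}_N):=\frac{\psi^N_{\bm{q}_2}(\bm{\theta}_N)}{\psi^N_{\bm{q}_1}(\bm{\theta}_N)}$$ is an eigenfunction of $\mathcal{K}$ with eigenvalue $0$ (that is, $\mathcal{K}\Psi^N_{\bm{q}_1,\bm{q}_2}=0$ for all $t$ at all points whose phases are pairwise distinct modulo $2\pi$), and thus it is an invariant of the system.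
   Context: The Koopman generator of the system acts on a continuously differentiable function $u$ of $\bm{\theta}_N$ by $$\mathcal{K}u=\sum_{j=1}^N(f+g\cos\theta_j+h\sin\theta_j)\frac{\partial u}{\partial\theta_j}.$$ For a permutation $\bm{q}=(q^{(1)},\dots,q^{(N)})$ of $\{1,\dots,N\}$, with the cyclic convention $q^{(N+1)}:=q^{(1)}$, $$\psi^N_{\bm{q}}(\bm{\theta}_N):=\frac{1}{\prod_{j=1}^N\sin\left(\frac{\theta_{q^{(j)}}-\theta_{q^{(j+1)}}}{2}\right)},$$ considered on the set of phases that are pairwise distinct modulo $2\pi$. An invariant is a function $w$ that is constant along trajectories: $w(\bm{\theta}_N(t))$ does not depend on $t$ for every solution $\bm{\theta}_N(t)$ lying in the domain of $w$. *)

(* Defs.v *)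
From mathcomp Require Import all_boot all_order all_algebra perm.
From mathcomp Require Import all_classical all_reals all_analysis.
Set Implicit Arguments.
Unset Strict Implicit.
Unset Printing Implicit Defensive.
Import Order.TTheory GRing.Theory Num.Theory.
Import numFieldNormedType.Exports.
Local Open Scope classical_set_scope.
Local Open Scope ring_scope.

(* C^k on D. Only meant for D open and V finite-dimensional: differentiability
   and continuity are those of u on all of V at the points of D, and the
   directional derivatives 'D_v, v ranging over V, then account for all
   partial derivatives. *)
Fixpoint Ck_on (R : realType) (V : normedModType R) (D : set V) (k : nat)
    (u : V -> R) : Prop :=
  match k with
  | 0 => forall x, D x -> {for x, continuous u}
  | k'.+1 => (forall x, D x -> differentiable u x) /\
             (forall v, Ck_on D k' ('D_v u))
  end.

Definition smooth (R : realType) (V : normedModType R) (u : V -> R) : Prop :=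
  forall k, Ck_on [set: V] k u.

Definition phase_periodic (R : realType) (N : nat)
    (F : 'rV[R]_N * R -> R) : Prop :=
  forall (theta : 'rV[R]_N) (t : R) (j : 'I_N),
    F (theta + (2 * pi) *: delta_mx 0 j, t) = F (theta, t).

Definition velocity (R : realType) (N : nat) (f g h : 'rV[R]_N * R -> R)
    (theta : 'rV[R]_N) (t : R) (j : 'I_N) : R :=
  f (theta, t) + g (theta, t) * cos (theta 0 j) + h (theta, t) * sin (theta 0 j).

(* The coefficients may depend on time, so the generator is indexed by t. *)
Definition koopman (R : realType) (N : nat) (f g h : 'rV[R]_N * R -> R) (t : R)
    (u : 'rV[R]_N -> R) (theta : 'rV[R]_N) : R :=
  \sum_(j < N) velocity f g h theta t j * 'D_(delta_mx 0 j) u theta.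

Definition distinct_phases (R : realType) (N : nat) : set 'rV[R]_N :=
  [set theta | forall i j : 'I_N, i != j ->
     forall k : int, theta 0 i - theta 0 j <> 2 * pi * k%:~R].

(* ordS is the cyclic successor on 'I_N. *)
Definition psi (R : realType) (N : nat) (q : {perm 'I_N})
    (theta : 'rV[R]_N) : R :=
  1 / \prod_(j < N) sin ((theta 0 (q j) - theta 0 (q (ordS j))) / 2).

Definition Psi (R : realType) (N : nat) (q1 q2 : {perm 'I_N})
    (theta : 'rV[R]_N) : R :=
  psi q2 theta / psi q1 theta.

(* The derivatives in koopman are total operators; the C^1 clause is what makes
   them genuine partial derivatives on D. *)
Definition koopman_eigenfunction (R : realType) (N : nat)
    (f g h : 'rV[R]_N * R -> R) (D : set 'rV[R]_N) (lambda : R)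
    (u : 'rV[R]_N -> R) : Prop :=
  [/\ Ck_on D 1 u,
      exists2 theta, D theta & u theta != 0 &
      forall (t : R) (theta : 'rV[R]_N), D theta ->
        koopman f g h t u theta = lambda * u theta].

(* I is any interval, open or not, bounded or not. Asking for the equation in
   the interior and for continuity up to the endpoints makes the values of
   theta outside I irrelevant. *)
Definition solution_on (R : realType) (N : nat) (f g h : 'rV[R]_N * R -> R)
    (I : set R) (theta : R -> 'rV[R]_N) : Prop :=
  {within I, continuous theta} /\
  forall t, I° t -> forall j : 'I_N,
    is_derive t (1 : R) (fun s => theta s 0 j) (velocity f g h (theta t) t j).

Definition invariant_on (R : realType) (N : nat) (f g h : 'rV[R]_N * R -> R)
    (D : set 'rV[R]_N) (w : 'rV[R]_N -> R) : Prop :=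
  forall (I : set R) (theta : R -> 'rV[R]_N), is_interval I ->
    solution_on f g h I theta -> (forall t, I t -> D (theta t)) ->
    forall s t, I s -> I t -> w (theta s) = w (theta t).

(* Main.v *)
Require Import Defs.
From mathcomp Require Import all_boot all_order all_algebra perm ring lra.
From mathcomp Require Import all_classical all_reals all_analysis.
Set Implicit Arguments.
Unset Strict Implicit.
Unset Printing Implicit Defensive.
Import Order.TTheory GRing.Theory Num.Theory.
Import numFieldNormedType.Exports.
Local Open Scope classical_set_scope.
Local Open Scope ring_scope.

(** Write P_q for the product of the sin((theta_{q(j)} - theta_{q(j+1)})/2), so
    that Psi q1 q2 = P_{q1} / P_{q2}. Along the flow each factor has logarithmic
    derivative c_a + c_b, where a = q(j), b = q(j+1) and
    c_a = (h cos theta_a - g sin theta_a)/2. Every index occurs exactly twice in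
    the cyclic product, so the logarithmic derivative of P_q is 2 sum_a c_a,
    independently of q, and that of the quotient vanishes. The generator is the
    directional derivative along the velocity, so the chain rule and the mean
    value theorem turn this into invariance along trajectories. *)

(** Differentiability is asked on a neighbourhood so that the product and inverse rules give ['D_v]
    near [x], and hence its continuity at [x]. Holding at every point of a set, this yields [Ck_on]
    of order 1 there without any appeal to openness. *)
Definition C1_at (R : realType) (V : normedModType R) (x : V) (u : V -> R) : Prop :=
  (\forall y \near x, differentiable u y) /\
  forall v, {for x, continuous ('D_v u)}.

Lemma near_eq_continuous_at (T U : topologicalType) (u w : T -> U) (x : T) :
  (\forall y \near x, u y = w y) -> {for x, continuous u} ->
  {for x, continuous w}.
Proof.
move=> uw cu; rewrite /prop_for /continuous_at -(nbhs_singleton uw).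
exact: cvg_trans (near_eq_cvg uw) cu.
Qed.

(** * Calculus of C^1 functions at a point *)

Section C1_at_theory.
Variables (R : realType) (V : normedModType R).
Implicit Types (x v : V) (u w : V -> R).

Lemma C1_at_diff x u : C1_at x u -> differentiable u x.
Proof. by case=> /nbhs_singleton. Qed.

Lemma C1_at_cst x (c : R) : C1_at x (cst c).
Proof.
split; first by near do exact: differentiable_cst.
move=> v; rewrite (_ : 'D_v _ = cst 0); first exact: cst_continuous.
by apply/funext => y; rewrite derive_cst.
Unshelve. all: by end_near. Qed.

Lemma C1_at_mul x u w : C1_at x u -> C1_at x w -> C1_at x (u * w).
Proof.
move=> Cu Cw; have [du cu] := Cu; have [dw cw] := Cw.
have ctu := differentiable_continuous (C1_at_diff Cu).
have ctw := differentiable_continuous (C1_at_diff Cw).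
split; first by near do apply: differentiableM.
move=> v; apply: (@near_eq_continuous_at _ _ (u * 'D_v w + w * 'D_v u)).
  near=> y; rewrite deriveM //; apply: diff_derivable.
    by near: y.
  by near: y.
apply: continuousD; apply: continuousM => //.
Unshelve. all: by end_near. Qed.

Lemma C1_at_inv x u : u x != 0 -> C1_at x u ->
  C1_at x (fun y => (u y)^-1).
Proof.
move=> ux0 Cu; have [du cu] := Cu.
have ctu := differentiable_continuous (C1_at_diff Cu).
have u0 : \forall y \near x, u y != 0.
  by apply: cvgr_neq0 ux0; exact: ctu.
split.
  near=> y; apply: differentiableV.
    by near: y.
  by near: y.
move=> v; apply: (@near_eq_continuous_at _ _ (fun y => - ((u y)^-1 * (u y)^-1) * 'D_v u y)).
  near=> y; rewrite deriveV ?expr2 ?invfM //.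
    by near: y.
  by apply: diff_derivable; near: y.
apply: continuousM; last exact: cu.
by apply: continuousN; apply: continuousM; exact: continuousV.
Unshelve. all: by end_near. Qed.

Lemma C1_at_prod (I : Type) (r : seq I) (F : I -> V -> R) x :
  (forall i, C1_at x (F i)) ->
  C1_at x (fun y => \prod_(i <- r) F i y).
Proof.
move=> CF; elim: r => [|i r IH].
  rewrite (_ : (fun y => _) = cst 1); first exact: C1_at_cst.
  by apply/funext => y; rewrite big_nil.
rewrite (_ : (fun y => _) = F i * (fun y => \prod_(i <- r) F i y)).
  exact: C1_at_mul.
by apply/funext => y; rewrite big_cons.
Qed.

(** Logarithmic differentiation without division: writing each derivative as [F i x * c i] keeps the
    rule valid where factors vanish. *)
Lemma is_derive_prod_log (I : Type) (r : seq I) (F : I -> V -> R) (c : I -> R) x v :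
  (forall i, is_derive x v (F i) (F i x * c i)) ->
  is_derive x v (fun y => \prod_(i <- r) F i y)
    ((\prod_(i <- r) F i x) * \sum_(i <- r) c i).
Proof.
move=> dF; elim: r => [|i r IH].
  rewrite (_ : (fun y => _) = cst 1); last by apply/funext => y; rewrite big_nil.
  by apply: is_derive_eq; rewrite !big_nil mulr0.
rewrite (_ : (fun y => _) = F i * (fun y => \prod_(i <- r) F i y)); last first.
  by apply/funext => y; rewrite big_cons.
apply: is_derive_eq; rewrite !big_cons /GRing.scale /=; ring.
Qed.

End C1_at_theory.

Lemma is_derive_comp1 (R : realType) (V : normedModType R) (G : R -> R)
    (l : V -> R) (x v : V) (dl dG : R) :
  differentiable l x -> is_derive x v l dl -> is_derive (l x) 1 G dG ->
  is_derive x v (G \o l) (dl * dG).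
Proof.
move=> diffl [_ <-] [dG1 <-].
have diffG : differentiable G (l x) by apply/derivable1_diffP.
apply: DeriveDef; first exact/diff_derivable/differentiable_comp.
rewrite deriveE; last exact: differentiable_comp.
by rewrite diff_comp //= deriv1E // derive1E [in RHS](deriveE v diffl).
Qed.

(** * Sines of half phase differences *)

Section half_angle.
Variables (R : realType) (N : nat).
Implicit Types (x v : 'rV[R]_N) (a b : 'I_N).

Lemma is_derive_coord x v a : is_derive x v (fun y : 'rV[R]_N => y 0 a : R) (v 0 a).
Proof.
apply: DeriveDef; first exact/diff_derivable/differentiable_coord.
have := derive_id x v; rewrite derive_mx; last exact: derivable_id.
by move=> /matrixP/(_ 0 a); rewrite mxE.
Qed.

Definition half_diff a b x : R := (x 0 a - x 0 b) / 2.

Lemma differentiable_half_diff x a b : differentiable (half_diff a b) x.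
Proof.
rewrite (_ : half_diff a b =
    2^-1 *: ((fun y : 'rV[R]_N => y 0 a : R) - (fun y => y 0 b))).
  apply: differentiableZ; apply: differentiableB; exact: differentiable_coord.
by apply/funext => y; rewrite /half_diff mulrC.
Qed.

(** [half_diff a b] is linear, so it is its own differential. *)
Lemma is_derive_half_diff x v a b :
  is_derive x v (half_diff a b) (half_diff a b v).
Proof.
rewrite (_ : half_diff a b =
    2^-1 *: ((fun y : 'rV[R]_N => y 0 a : R) - (fun y => y 0 b))).
  apply: is_deriveZ; apply: is_deriveB; exact: is_derive_coord.
by apply/funext => y; rewrite /half_diff mulrC.
Qed.

Lemma is_derive_sin_half_diff x v a b :
  is_derive x v (fun y => sin (half_diff a b y))
    (half_diff a b v * cos (half_diff a b x)).
Proof.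
apply: (is_derive_comp1 (G := sin)) => //; first exact: differentiable_half_diff.
exact: is_derive_half_diff.
Qed.

Lemma C1_at_sin_half_diff x a b :
  C1_at x (fun y => sin (half_diff a b y)).
Proof.
split.
  near=> y; apply: (@differentiable_comp _ _ _ _ (half_diff a b) sin).
    exact: differentiable_half_diff.
  exact/derivable1_diffP.
move=> v; rewrite (_ : 'D_v _ = fun y => half_diff a b v * cos (half_diff a b y)).
  apply: continuousM; first exact: cst_continuous.
  apply: continuous_comp; last exact: continuous_cos.
  exact/differentiable_continuous/differentiable_half_diff.
by apply/funext => y; case: (is_derive_sin_half_diff y v a b).
Unshelve. all: by end_near. Qed.

End half_angle.

(** Reduce [a] modulo pi to some [b] in [0, pi). Then sin b = ± sin a = 0, and positivity of sine on
    (0, pi) leaves only b = 0. *)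
Lemma sin_eq0 (R : realType) (a : R) :
  sin a = 0 -> exists k : int, a = pi * k%:~R.
Proof.
move=> sa; exists (Num.floor (a / pi)).
set k := Num.floor _; pose b := a - pi * k%:~R.
have p0 : 0 < pi :> R := pi_gt0 R.
have kle : k%:~R <= a / pi by exact: Num.Theory.floor_le.
have klt : a / pi < (k + 1)%:~R by exact: floorD1_gt.
have b0 : 0 <= b by rewrite subr_ge0 mulrC -ler_pdivlMr.
have bpi : b < pi.
  by move: klt; rewrite ltr_pdivrMr // intrD mulrDl mul1r /b (mulrC pi) ltrBlDl.
have sb : sin b = 0.
  (* Antiperiodicity is available for natural multiples of pi: for k >= 0 it is applied at a - k pi
     and the sign cancelled, for k < 0 directly at [a]. *)
  rewrite /b; case: (k) => n.
    rewrite -pmulrn; have := alternatingn (@sinDpi R) n (a - pi * n%:R).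
    rewrite -[pi *+ n]mulr_natr subrK sa => /esym/eqP.
    by rewrite mulf_eq0 signr_eq0 => /eqP.
  by rewrite NegzE mulrNz mulrN opprK -pmulrn mulr_natr
    (alternatingn (@sinDpi R)) sa mulr0.
have : b = 0.
  move: b0; rewrite le_eqVlt => /predU1P[//|b0].
  by have := @sin_gt0_pi R b; rewrite b0 bpi sb ltxx => /(_ isT).
by move/eqP; rewrite subr_eq0 => /eqP.
Qed.

(** * Cyclic products of sines, their quotients, and the flow *)

Section phase_products.
Variables (R : realType) (N : nat).
Implicit Types (x : 'rV[R]_N) (q : {perm 'I_N}).

Definition phase_prod q x : R :=
  \prod_(j < N) sin (half_diff (q j) (q (ordS j)) x).

Lemma C1_at_phase_prod q x : C1_at x (phase_prod q).
Proof.
by apply: (@C1_at_prod _ _ _ _ (fun j y => sin (half_diff (q j) (q (ordS j)) y)))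
  => j; exact: C1_at_sin_half_diff.
Qed.

(** With mean m and half difference d of the two angles, f cancels and sum-to-product formulas turn
    both sides into sin d cos d (h cos m - g sin m). *)
Lemma half_velocity_diff (f g h a b : R) :
  ((f + g * cos a + h * sin a) - (f + g * cos b + h * sin b)) / 2
    * cos ((a - b) / 2) =
  sin ((a - b) / 2) *
    ((h * cos a - g * sin a) / 2 + (h * cos b - g * sin b) / 2).
Proof.
pose m := (a + b) / 2; pose d := (a - b) / 2.
have -> : a = m + d by rewrite /m /d; field.
have -> : b = m - d by rewrite /m /d; field.
have -> : (m + d - (m - d)) / 2 = d by field.
by rewrite cosB sinB cosD sinD; field.
Qed.

(** The direction is the velocity frozen at [(x, t)], so no derivative of f, g or h appears. *)
Lemma is_derive_phase_prod q f g h t x :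
  is_derive x (\row_j velocity f g h x t j) (phase_prod q)
    (phase_prod q x *
      \sum_(j < N) (h (x, t) * cos (x 0 j) - g (x, t) * sin (x 0 j))).
Proof.
pose c j := (h (x, t) * cos (x 0 j) - g (x, t) * sin (x 0 j)) / 2.
have -> : \sum_(j < N) (h (x, t) * cos (x 0 j) - g (x, t) * sin (x 0 j)) =
    \sum_(j < N) (c (q j) + c (q (ordS j))).
  transitivity (\sum_(j < N) c j + \sum_(j < N) c j).
    by rewrite -big_split /=; apply: eq_bigr => j _; rewrite /c; field.
  (* Both [q] and its composite with [ordS] are bijections of the indices, so each half of the sum
     is a reindexed sum of [c]. *)
  rewrite [RHS]big_split; congr (_ + _); first exact/reindex_inj/perm_inj.
  exact/reindex_inj/inj_comp/ordS_inj/perm_inj.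
apply: (@is_derive_prod_log _ _ _ _ (fun j y => sin (half_diff (q j) (q (ordS j)) y)))
  => j.
apply: is_derive_eq; first exact: is_derive_sin_half_diff.
by rewrite /half_diff !mxE half_velocity_diff.
Qed.

(** Inversion is total and involutive, even at 0, so this is an equality of functions on all phases
    and can be rewritten under derivatives. *)
Lemma PsiE q1 q2 : Psi q1 q2 = phase_prod q1 * (fun y => (phase_prod q2 y)^-1).
Proof. by apply/funext => y; rewrite /Psi /psi !div1r invrK mulrC. Qed.

Lemma C1_at_Psi q1 q2 x : phase_prod q2 x != 0 -> C1_at x (Psi q1 q2).
Proof.
move=> P0; rewrite PsiE; apply: C1_at_mul; first exact: C1_at_phase_prod.
by apply: C1_at_inv => //; exact: C1_at_phase_prod.
Qed.

Lemma derive_Psi q1 q2 f g h t x : phase_prod q2 x != 0 ->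
  'D_(\row_j velocity f g h x t j) (Psi q1 q2) x = 0.
Proof.
move=> P0; rewrite PsiE.
have [d1 e1] := is_derive_phase_prod q1 f g h t x.
have [d2 e2] := is_derive_phase_prod q2 f g h t x.
rewrite deriveM //; last exact: derivableV.
by rewrite deriveV // e1 e2 /GRing.scale /=; field.
Qed.

(** The differential is linear, and the velocity expands in the basis [delta_mx 0 j]. *)
Lemma koopmanE f g h t (u : 'rV[R]_N -> R) x : differentiable u x ->
  koopman f g h t u x = 'D_(\row_j velocity f g h x t j) u x.
Proof.
move=> du; rewrite deriveE // [X in 'd u x X]row_sum_delta linear_sum.
by apply: eq_bigr => j _; rewrite linearZ mxE deriveE.
Qed.

Lemma ordS_neq (j : 'I_N) : (1 < N)%N -> ordS j != j.
Proof.
move=> N1; apply/eqP => /(congr1 val) /=.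
have := ltn_ord j; rewrite leq_eqVlt => /predU1P[jN|jN].
  (* Wraparound: the last index goes to 0, so fixing it would force N = 1. *)
  by rewrite jN modnn => j0; move: N1; rewrite -jN -j0.
by rewrite modn_small // => /eqP; rewrite eqn_leq ltnn.
Qed.

(** Cyclic neighbours carry different indices, and a vanishing half-angle sine would make their
    phases equal modulo 2 pi. *)
Lemma phase_prod_neq0 q x : (1 < N)%N -> distinct_phases x -> phase_prod q x != 0.
Proof.
move=> N1 Dx; apply/prodf_neq0 => j _; apply/eqP => /sin_eq0[k xk].
apply: (Dx (q j) (q (ordS j)) _ k).
  by rewrite (inj_eq perm_inj) eq_sym ordS_neq.
by rewrite -mulrA -xk /half_diff; field.
Qed.

Lemma distinct_phases_exists : exists x : 'rV[R]_N, distinct_phases x.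
Proof.
(* These phases lie in [0, 1), so their differences are below 1 in size, whereas a nonzero multiple
   of 2 pi has size at least 4; only k = 0 remains. *)
exists (\row_j (j%:R / N%:R)) => i j ij k; rewrite !mxE => ijk.
have N0 : 0 < N%:R :> R by rewrite ltr0n (leq_ltn_trans _ (ltn_ord i)).
have bnd (l : 'I_N) : 0 <= (l%:R / N%:R : R) < 1.
  by rewrite divr_ge0 // ltr_pdivrMr // mul1r ltr_nat ltn_ord.
have /andP[i0 i1] := bnd i; have /andP[j0 j1] := bnd j.
have pi2 := pi_ge2 R.
have [k1|k1|k0] := ltgtP k 0.
- have : k%:~R <= (-1)%:~R :> R by rewrite ler_int -ltzD1 addNr.
  nra.
- have : 1%:~R <= k%:~R :> R by rewrite ler_int -gtz0_ge1.
  nra.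
move: ijk; rewrite k0 mulr0 => /eqP; rewrite subr_eq0 => /eqP.
move/(mulIf (invr_neq0 (lt0r_neq0 N0))) => /eqP; rewrite eqr_nat => /eqP ij'.
by move: ij; rewrite (_ : i = j) ?eqxx //; exact: val_inj.
Qed.

Lemma Psi_invariant q1 q2 f g h :
  (1 < N)%N -> invariant_on f g h (@distinct_phases R N) (Psi q1 q2).
Proof.
move=> N1 I theta Iitv [theta_c theta_d] ID.
suff main s t : I s -> I t -> s < t ->
    Psi q1 q2 (theta s) = Psi q1 q2 (theta t).
  move=> s t Is It; have [st|ts|->//] := ltgtP s t; first exact: main.
  exact/esym/main.
move=> Is It st.
have sub : `[s, t]%classic `<=` I.
  by move=> r; rewrite /= in_itv; exact: Iitv.
(* The mean value theorem needs a derivative only inside ]s, t[, which lies in the interior of [I]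
   where the equation holds; at s and t continuity suffices. *)
have [r rst||c _ /eqP] := @MVT R (Psi q1 q2 \o theta) (cst 0) s t st.
- have Ir : I° r by apply: (interiorS sub); rewrite interior_itv.
  have P0 : phase_prod q2 (theta r) != 0.
    by apply: phase_prod_neq0 => //; exact: ID (interior_subset Ir).
  have dtheta : derivable theta r 1.
    by apply/derivable_mxP => i j; rewrite ord1; case: (theta_d r Ir j).
  have dPsi : differentiable (Psi q1 q2) (theta r).
    by apply: C1_at_diff; exact: C1_at_Psi.
  apply: DeriveDef.
    apply/derivable1_diffP/differentiable_comp => //.
    exact/derivable1_diffP.
  rewrite deriveE; last first.
    by apply/differentiable_comp => //; exact/derivable1_diffP.
  rewrite diff_comp //=; last exact/derivable1_diffP.
  rewrite -!deriveE //; last exact/derivable1_diffP.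
  rewrite (_ : 'D_1 theta r = \row_j velocity f g h (theta r) r j).
    exact: derive_Psi.
  apply/rowP => j; rewrite derive_mx // !mxE.
  by case: (theta_d r Ir j).
- apply: (continuous_subspaceW sub).
  apply/subspace_continuousP => r Ir; apply: continuous_cvg.
    apply: differentiable_continuous; apply: C1_at_diff; apply: C1_at_Psi.
    by apply: phase_prod_neq0 => //; exact: ID.
  by move/subspace_continuousP: theta_c; exact.
- by rewrite mul0r subr_eq0 => /eqP.
Qed.

End phase_products.

Theorem theorem4 (R : realType) (N : nat) (hN : (3 <= N)%N)
    (f g h : 'rV[R]_N * R -> R)
    (f_smooth : smooth f) (g_smooth : smooth g) (h_smooth : smooth h)
    (f_per : phase_periodic f) (g_per : phase_periodic g)
    (h_per : phase_periodic h) (q1 q2 : {perm 'I_N}) :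
  koopman_eigenfunction f g h (@distinct_phases R N) 0 (Psi q1 q2) /\
  invariant_on f g h (@distinct_phases R N) (Psi q1 q2).
Proof.
have N1 : (1 < N)%N := ltnW hN.
split; last exact: Psi_invariant.
have C1 (x : 'rV[R]_N) : distinct_phases x -> C1_at x (Psi q1 q2).
  by move=> Dx; apply: C1_at_Psi; exact: phase_prod_neq0.
split.
- split=> [x Dx | v x Dx]; first exact/C1_at_diff/C1.
  exact: (C1 x Dx).2.
- have [x Dx] := distinct_phases_exists R N; exists x => //.
  by rewrite PsiE mulf_neq0 ?invr_neq0 ?phase_prod_neq0.
move=> t x Dx; rewrite mul0r koopmanE; last exact/C1_at_diff/C1.
exact/derive_Psi/phase_prod_neq0.
Qed.
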